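(* Let $\mathcal A$ be a unital $C^*$-algebra and let $\mathcal F\subseteq\mathcal A$ be an algebra of finite type elements. If $t_1,t_2\in\mathcal A$ are of Fredholm type, then $t_1t_2$ is of Fredholm type and $$\operatorname{ind}(t_1t_2)=\operatorname{ind}t_1+\operatorname{ind}t_2 \quad\text{in } K(\mathcal F).$$ In other words, the set of Fredholm type elements is a multiplicative semigroup with unit and $\operatorname{ind}$ is a homomorphism from it to $(K(\mathcal F),+)$.
   Context: Let $\mathcal A$ be a unital $C^*$-algebra. A subalgebra $\mathcal F\subseteq\mathcal A$ is an algebra of finite type elements if: (i) $\mathcal F$ is a self-adjoint two-sided ideal of $\mathcal A$; (ii) $\mathcal F$ has an approximate unit consisting of projections, i.e. a net $(p_\alpha)$ of projections in $\mathcal F$ with $\|f-p_\alpha f\|\to0$ and $\|f-fp_\alpha\|\to0$ for every $f\in\mathcal F$; (iii) for any projections $p,q\in\mathcal F$ there is $v\in\mathcal A$ with $vv^*=q$ and $v^*vp=0$ (so $v^*v+p$ is a projection). Projections $p,q$ are (Murray–von Neumann) equivalent, $p\sim q$, if there is $v\in\mathcal A$ with $vv^*=p$, $v^*v=q$. $\mathrm{Proj}(\mathcal F)/\sim$ is a commutative semigroup under $[p]+[q]=[p+v^*v]$ with $v$ as in (iii), and $K(\mathcal F)$ denotes its Grothendieck group. For $a\in\mathcal A$ and projections $p,q\in\mathcal A$, $a$ is invertible up to $(p,q)$ if there is $b\in\mathcal A$ with $b=(1-p)b(1-q)$, $(1-q)a(1-p)b=1-q$ and $b(1-q)a(1-p)=1-p$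 ($b$ is a $(p,q)$-inverse of $a$). $a$ is of Fredholm type if it is invertible up to $(p,q)$ for some projections $p,q\in\mathcal F$, and then $\operatorname{ind}a=[p]-[q]\in K(\mathcal F)$ (this does not depend on the choice of $p,q$). *)

(* Defs.v *)
From mathcomp Require Import all_boot all_order all_algebra.
From mathcomp Require Import reals complex.
Set Implicit Arguments. Unset Strict Implicit. Unset Printing Implicit Defensive.
Import Order.TTheory GRing.Theory Num.Theory.
Local Open Scope ring_scope.

Record is_unital_cstar (R : realType) (A : algType R[i])
    (star : A -> A) (nrm : A -> R) : Prop := IsUnitalCStar {
  nrm_ge0 : forall x, 0 <= nrm x;
  nrm_eq0 : forall x, nrm x = 0 -> x = 0;
  nrm_triangle : forall x y, nrm (x + y) <= nrm x + nrm y;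
  nrm_scale : forall (c : R[i]) x, nrm (c *: x) = Normc.normc c * nrm x;
  nrm_submult : forall x y, nrm (x * y) <= nrm x * nrm y;
  nrm_complete : forall u : nat -> A,
    (forall e : R, 0 < e -> exists N, forall m n, (N <= m)%N -> (N <= n)%N ->
        nrm (u m - u n) < e) ->
    exists l : A, forall e : R, 0 < e -> exists N, forall n, (N <= n)%N ->
        nrm (u n - l) < e;
  star_add : forall x y, star (x + y) = star x + star y;
  star_scale : forall (c : R[i]) x, star (c *: x) = conjc c *: star x;
  star_mul : forall x y, star (x * y) = star y * star x;
  star_invol : forall x, star (star x) = x;
  cstar_identity : forall x, nrm (star x * x) = nrm x ^+ 2
}.

Section FiniteType.
Variables (R : realType) (A : algType R[i]) (star : A -> A) (nrm : A -> R).

Definition is_proj (p : A) : Prop := p * p = p /\ star p = p.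

Definition projF (F : A -> Prop) (p : A) : Prop := F p /\ is_proj p.

Record directed (I : Type) (le : I -> I -> Prop) : Prop := Directed {
  directed_inhabited : exists i : I, True;
  directed_refl : forall i, le i i;
  directed_trans : forall i j k, le i j -> le j k -> le i k;
  directed_upper : forall i j, exists k, le i k /\ le j k
}.

Record finite_type_algebra (F : A -> Prop) : Prop := FiniteTypeAlgebra {
  fta_0 : F 0;
  fta_add : forall x y, F x -> F y -> F (x + y);
  fta_scale : forall (c : R[i]) x, F x -> F (c *: x);
  fta_mull : forall a x, F x -> F (a * x);
  fta_mulr : forall a x, F x -> F (x * a);
  fta_star : forall x, F x -> F (star x);
  fta_approx_unit : exists (I : Type) (le : I -> I -> Prop) (p : I -> A),
      directed le /\ (forall i, projF F (p i)) /\
      forall f, F f -> forall e : R, 0 < e -> exists i0, forall i, le i0 i ->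
        nrm (f - p i * f) < e /\ nrm (f - f * p i) < e;
  fta_orth : forall p q, projF F p -> projF F q ->
      exists v : A, v * star v = q /\ star v * v * p = 0
}.

Definition mvn_equiv (p q : A) : Prop :=
  exists v : A, v * star v = p /\ star v * v = q.

(** [s] represents the class [p] + [q] in Proj(F)/~ :
    [p]+[q] = [p + v^* v] with v as in (iii). *)
Definition is_sum_class (F : A -> Prop) (p q s : A) : Prop :=
  projF F s /\ exists v : A, v * star v = q /\ star v * v * p = 0 /\
                             mvn_equiv s (p + star v * v).

Definition is_sum4_class (F : A -> Prop) (a1 a2 a3 a4 s : A) : Prop :=
  exists s1 s2, is_sum_class F a1 a2 s1 /\ is_sum_class F s1 a3 s2 /\
                is_sum_class F s2 a4 s.

(** Equality in the Grothendieck group K(F) of Proj(F)/~ :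
    ([p]-[q]) = ([p1]-[q1]) + ([p2]-[q2]) holds iff there is a class [r] with
    [p] + [q1] + [q2] + [r] = [p1] + [p2] + [q] + [r] in Proj(F)/~. *)
Definition K_eq_sum (F : A -> Prop) (p q p1 q1 p2 q2 : A) : Prop :=
  exists r s t, projF F r /\ is_sum4_class F p q1 q2 r s /\
                is_sum4_class F p1 p2 q r t /\ mvn_equiv s t.

Definition inv_up_to (a p q : A) : Prop :=
  exists b : A, b = (1 - p) * b * (1 - q) /\
    (1 - q) * a * (1 - p) * b = 1 - q /\
    b * (1 - q) * a * (1 - p) = 1 - p.

Definition fredholm_type (F : A -> Prop) (a : A) : Prop :=
  exists p q, projF F p /\ projF F q /\ inv_up_to a p q.

End FiniteType.

(* Main.v *)
Require Import Defs.
From Stdlib Require Import Ncring Ncring_tac.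
From mathcomp Require Import all_boot all_order all_algebra.
From mathcomp Require Import reals complex ring lra.
Set Implicit Arguments. Unset Strict Implicit. Unset Printing Implicit Defensive.
Import Order.TTheory GRing.Theory Num.Theory.
Local Open Scope ring_scope.

(* Existence: [t] is of Fredholm type iff it is invertible modulo [F], the
   exact kernel projection being the range projection [f (f + f^* - 1)^-1] of an
   idempotent [f] in [F]. Index: a [(p, q)]-inverse of [t] makes [[t, q], [p, 0]]
   an isomorphism from A + qA to A + pA. Composing those of [t2] and [t1] gives an
   isomorphism from A + q2 A + q1 A to A + p2 A + p1 A with corner entry
   [t1 t2], and the Schur complement of its invertible corner from (1 - p)A to
   (1 - q)A identifies pA + q2 A + q1 A with qA + p2 A + p1 A. Algebraically
   equivalent projections are Murray-von Neumann equivalent: after making them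
   orthogonal, an isomorphism is the off-diagonal part of a selfadjoint
   invertible [h], and the sign of [h], obtained by Newton's iteration
   [s (3 - s^2) / 2], swaps the two projections. The iteration converges because
   [nrm (c - h^2) < c] for large [c], which is proved from the C*-identity. *)

(** * Noncommutative ring identities by reflection *)

Section NcRing.
Variable A : nzRingType.

#[export] Instance nzRing_ops :
  Ring_ops (T:=A) (ring0:=0) (ring1:=1) (add:=+%R) (mul:= *%R)
    (sub:=fun x y => x - y) (opp:=-%R) (ring_eq:=@eq A) := {}.

#[export] Instance nzRing_ncring : Ring (Ro:=nzRing_ops).
Proof.
constructor => //.
- exact: eq_equivalence.
- by move=> ? ? -> ? ? ->.
- by move=> ? ? -> ? ? ->.
- by move=> ? ? -> ? ? ->.
- by move=> ? ? ->.
- exact: add0r.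
- exact: addrC.
- exact: addrA.
- exact: mul1r.
- exact: mulr1.
- exact: mulrA.
- exact: mulrDl.
- by move=> *; exact: mulrDr.
- exact: subrr.
Qed.

End NcRing.

(** * Real geometric sequences *)

Lemma expr_bernoulli (R : realFieldType) (d : R) (n : nat) :
  0 <= d -> d <= 1 -> (1 - d) ^+ n * (1 + n%:R * d) <= 1.
Proof.
move=> d0 d1; elim: n => [|n IH]; first by rewrite expr0 !mul0r addr0 mulr1.
apply: le_trans IH; rewrite exprSr -mulrA ler_wpM2l ?exprn_ge0 ?subr_ge0 //.
by rewrite -natr1; have := ler0n R n; nra.
Qed.

(** [expr_bernoulli] with d = 1 - r gives r^n (1 + n d) <= 1, so any n above 1 / (e d) will do. *)
Lemma expr_small (R : realType) (r e : R) :
  0 <= r -> r < 1 -> 0 < e -> exists n : nat, r ^+ n < e.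
Proof.
move=> r0 r1 e0; set d := 1 - r.
have d0 : 0 < d by rewrite subr_gt0.
have [n hn] : exists n : nat, (e * d)^-1 < n%:R.
  by exists (Num.bound (e * d)^-1); apply: archi_boundP; rewrite invr_ge0; nra.
exists n; have d1 : d <= 1 by rewrite /d; lra.
have := expr_bernoulli n (ltW d0) d1; have -> : 1 - d = r by rewrite /d; lra.
have ed0 : 0 < e * d by nra.
have h1 : 1 < n%:R * (e * d) by rewrite -ltr_pdivrMr // div1r.
have := exprn_ge0 n r0; set a := r ^+ n; set m := n%:R in h1 * => a0 h2.
rewrite ltNge; apply/negP => ea.
have : e * (1 + m * d) <= 1 by apply: le_trans h2; apply: ler_wpM2r => //; nra.
nra.
Qed.

(** * Two-sided invertibility in a ring *)

Definition invertible (A : nzRingType) (a : A) : Prop :=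
  exists b, a * b = 1 /\ b * a = 1.

Section Invertible.
Variable A : nzRingType.
Implicit Types a b c : A.

Lemma invertibleM a b : invertible a -> invertible b -> invertible (a * b).
Proof.
move=> [a' [aa' a'a]] [b' [bb' b'b]]; exists (b' * a'); split.
  by rewrite mulrA -(mulrA a) bb' mulr1.
by rewrite mulrA -(mulrA b') a'a mulr1.
Qed.

Lemma invertible_lr a b c : b * a = 1 -> a * c = 1 -> invertible a.
Proof.
move=> ba ac; exists b; split=> //.
suff -> : b = c by [].
by rewrite -[b]mulr1 -ac mulrA ba mul1r.
Qed.

(** Commutation makes [c * b] a left inverse and [b * c] a right inverse of [a]. Taken with b = a,
    this reduces invertibility of an element to that of its square. *)
Lemma invertible_comm_factor a b :
  a * b = b * a -> invertible (a * b) -> invertible a.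
Proof.
move=> ab [c [abc cab]]; apply: (@invertible_lr _ (c * b) (b * c)).
  by rewrite -mulrA -ab.
by rewrite mulrA.
Qed.

End Invertible.

(** * Norm, limits and invertibility in a unital C*-algebra *)

Section CStar.
Variables (R : realType) (A : algType R[i]) (star : A -> A) (nrm : A -> R).
Hypothesis hC : is_unital_cstar star nrm.
Implicit Types (a b x y h k s t : A) (r c : R).

Local Notation "r *r x" := ((r%:C)%C *: x) (at level 40).

Lemma nrmZr r x : nrm (r *r x) = `|r| * nrm x.
Proof. by rewrite (nrm_scale hC) /= expr0n addr0 sqrtr_sqr. Qed.

Lemma nrmN x : nrm (- x) = nrm x.
Proof.
have -> : - x = (-1) *r x by rewrite rmorphN rmorph1 scaleN1r.
by rewrite nrmZr normrN normr1 mul1r.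
Qed.

Lemma nrm0 : nrm 0 = 0.
Proof. by rewrite -(scale0r (0 : A)) (nrm_scale hC) Normc.normc0 mul0r. Qed.

Lemma nrm_triangle_sub x y : nrm (x - y) <= nrm x + nrm y.
Proof. by rewrite -(nrmN y) (nrm_triangle hC). Qed.

Lemma nrm_subC x y : nrm (x - y) = nrm (y - x).
Proof. by rewrite -nrmN opprB. Qed.

Lemma star0 : star 0 = 0.
Proof. by rewrite -(scale0r (0 : A)) (star_scale hC) conjc0 !scale0r. Qed.

Lemma starN x : star (- x) = - star x.
Proof. by apply/eqP; rewrite -addr_eq0 -(star_add hC) addNr star0. Qed.

Lemma starB x y : star (x - y) = star x - star y.
Proof. by rewrite (star_add hC) starN. Qed.

Lemma star1 : star 1 = 1.
Proof.
have h x : star 1 * x = x.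
  by rewrite -{1}(star_invol hC x) -(star_mul hC) mulr1 (star_invol hC).
by rewrite -[LHS]mulr1 h.
Qed.

Lemma starZr r x : star (r *r x) = r *r star x.
Proof. by rewrite (star_scale hC) conjc_real. Qed.

(** The C*-identity and submultiplicativity give |y|^2 <= |y^*| |y|; dividing by |y| and taking y =
    x, then y = x^*, yields both inequalities. *)
Lemma nrm_star x : nrm (star x) = nrm x.
Proof.
have le y : nrm y <= nrm (star y).
  have [y0|y0] := leP (nrm y) 0; first by apply: le_trans y0 (nrm_ge0 hC _).
  rewrite -(ler_pM2r y0) -expr2 -(cstar_identity hC).
  exact: (nrm_submult hC).
by apply: le_anti; rewrite le -{2}(star_invol hC x) le.
Qed.

Lemma nrm_sqr_sa x : star x = x -> nrm (x * x) = nrm x ^+ 2.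
Proof. by move=> sx; rewrite -(cstar_identity hC) sx. Qed.

Lemma nrm1 : nrm 1 = 1.
Proof.
have h : nrm 1 = nrm 1 ^+ 2 by rewrite -(nrm_sqr_sa star1) mulr1.
have [h0|h0] := eqVneq (nrm 1) 0.
  by have := oner_neq0 A; rewrite (nrm_eq0 hC h0) eqxx.
by apply: (mulfI h0); rewrite -expr2 -h mulr1.
Qed.

Lemma nrm_eq0_small x : (forall e, 0 < e -> nrm x < e) -> x = 0.
Proof.
move=> h; apply: (nrm_eq0 hC); apply/eqP/negP => n0.
have : 0 < nrm x by rewrite lt0r; apply/andP; split; [exact/negP|exact: (nrm_ge0 hC)].
by move/h; rewrite ltxx.
Qed.

Definition cvg_nrm (u : nat -> A) (l : A) : Prop :=
  forall e : R, 0 < e -> exists N, forall n, (N <= n)%N -> nrm (u n - l) < e.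

Lemma cvg_nrm_eq u v l m :
  cvg_nrm u l -> cvg_nrm v m -> (forall n, u n = v n) -> l = m.
Proof.
move=> cu cv uv; apply/eqP; rewrite -subr_eq0; apply/eqP.
apply: nrm_eq0_small => e e0.
have e2 : 0 < e / 2 by lra.
have [N hN] := cu _ e2; have [M hM] := cv _ e2.
have := hN _ (leq_maxl N M); have := hM _ (leq_maxr N M).
rewrite -uv; set w := u _ => h1 h2.
have -> : l - m = (w - m) - (w - l) by non_commutative_ring.
by apply: le_lt_trans (nrm_triangle_sub _ _) _; lra.
Qed.

Lemma cvg_nrm_le u l (v : nat -> A) m C :
  cvg_nrm u l -> 0 <= C -> (forall n, nrm (v n - m) <= C * nrm (u n - l)) ->
  cvg_nrm v m.
Proof.
move=> cu C0 h e e0; have C1 : 0 < C + 1 by lra.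
have [N hN] := cu (e / (C + 1)) (divr_gt0 e0 C1).
exists N => n /hN; rewrite ltr_pdivlMr // => h1.
by apply: le_lt_trans (h n) _; have := nrm_ge0 hC (u n - l); nra.
Qed.

Lemma cvg_nrmMl a u l : cvg_nrm u l -> cvg_nrm (fun n => a * u n) (a * l).
Proof.
move=> cu; apply: (cvg_nrm_le cu (nrm_ge0 hC a)) => n.
by rewrite -mulrBr (nrm_submult hC).
Qed.

Lemma cvg_nrmMr a u l : cvg_nrm u l -> cvg_nrm (fun n => u n * a) (l * a).
Proof.
move=> cu; apply: (cvg_nrm_le cu (nrm_ge0 hC a)) => n.
by rewrite -mulrBl mulrC (nrm_submult hC).
Qed.

Lemma cvg_nrm_star u l : cvg_nrm u l -> cvg_nrm (fun n => star (u n)) (star l).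
Proof.
move=> cu; apply: (cvg_nrm_le cu ler01) => n.
by rewrite -starB nrm_star mul1r.
Qed.

Lemma cvg_nrmM u v l m C : (forall n, nrm (u n) <= C) ->
  cvg_nrm u l -> cvg_nrm v m -> cvg_nrm (fun n => u n * v n) (l * m).
Proof.
move=> uC cu cv e e0; have C0 : 0 <= C by apply: le_trans (uC 0%N); exact: (nrm_ge0 hC).
have m0 := nrm_ge0 hC m.
have e1 : 0 < e / (C + nrm m + 1) by apply: divr_gt0 => //; lra.
have [N hN] := cu _ e1; have [M hM] := cv _ e1.
exists (maxn N M) => n; rewrite geq_max => /andP [/hN h1 /hM h2].
have -> : u n * v n - l * m = u n * (v n - m) + (u n - l) * m.
  by non_commutative_ring.
apply: le_lt_trans (nrm_triangle hC _ _) _.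
apply: le_lt_trans (lerD (nrm_submult hC _ _) (nrm_submult hC _ _)) _.
move: h1 h2; rewrite !ltr_pdivlMr; try by lra.
have := uC n; move: (nrm_ge0 hC (v n - m)) (nrm_ge0 hC (u n - l)) (nrm_ge0 hC (u n)).
set p := nrm (v n - m); set q := nrm (u n - l); set w := nrm (u n); nra.
Qed.

Lemma cvg_nrm0_geom u C r : 0 <= r -> r < 1 ->
  (forall n, nrm (u n) <= C * r ^+ n) -> cvg_nrm u 0.
Proof.
move=> r0 r1 h e e0.
have C0 : 0 <= C by have := h 0%N; rewrite expr0 mulr1; apply: le_trans (nrm_ge0 hC _).
have C1 : 0 < C + 1 by lra.
have [N hN] := expr_small r0 r1 (divr_gt0 e0 C1).
exists N => n Nn; rewrite subr0; apply: le_lt_trans (h n) _.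
have rn : r ^+ n <= r ^+ N by apply: ler_wiXn2l => //; exact: ltW.
move: hN; rewrite ltr_pdivlMr //; have := exprn_ge0 n r0; nra.
Qed.

(** Telescoping bounds (1 - r) |u (n + k) - u n| by C (r^n - r^(n + k)), so the sequence is Cauchy.
    The factor 1 - r stays on the left to avoid a division in the induction. *)
Lemma cvg_nrm_geom (u : nat -> A) C r : 0 <= r -> r < 1 ->
  (forall n, nrm (u n.+1 - u n) <= C * r ^+ n) -> exists l, cvg_nrm u l.
Proof.
move=> r0 r1 h; apply: (nrm_complete hC) => e e0.
have C0 : 0 <= C by have := h 0%N; rewrite expr0 mulr1; apply: le_trans (nrm_ge0 hC _).
have d0 : 0 < 1 - r by lra.
have tele n (k : nat) : nrm (u (n + k)%N - u n) * (1 - r) <= C * (r ^+ n - r ^+ (n + k)).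
  elim: k => [|k IH]; first by rewrite addn0 !subrr nrm0 mul0r mulr0.
  rewrite addnS; have -> : u (n + k).+1 - u n =
      (u (n + k).+1 - u (n + k)%N) + (u (n + k)%N - u n) by non_commutative_ring.
  have := nrm_triangle hC (u (n + k).+1 - u (n + k)%N) (u (n + k)%N - u n).
  have := h (n + k)%N; rewrite exprS; move: IH.
  set X := nrm (u (n + k).+1 - u _); set Y := nrm (u (n + k)%N - u n).
  set Z := nrm (_ + _).
  set rn := r ^+ n; set rk := r ^+ (n + k) => h1 h2 h3.
  apply: le_trans (ler_wpM2r (ltW d0) h3) _; nra.
(* Two distances to [u N] are added, each costing C r^N; the extra 1 keeps the denominator positive
   when C = 0. *)
have e1 : 0 < e * (1 - r) / (C + C + 1).
  by apply: divr_gt0; [apply: mulr_gt0 | lra].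
have [N hN] := expr_small r0 r1 e1.
have close n : (N <= n)%N -> nrm (u n - u N) * (1 - r) <= C * r ^+ N.
  move=> Nn; rewrite -(subnKC Nn); apply: le_trans (tele _ _) _.
  by have := exprn_ge0 (N + (n - N)) r0; nra.
exists N => m n /close hm /close hn.
have -> : u m - u n = (u m - u N) - (u n - u N) by non_commutative_ring.
apply: le_lt_trans (nrm_triangle_sub _ _) _.
rewrite -(ltr_pM2r d0); move: hN; rewrite ltr_pdivlMr; last by lra.
have := exprn_ge0 N r0; move: hm hn; nra.
Qed.

(** The partial sums of the geometric series converge by [cvg_nrm_geom]; multiplied by 1 - a on
    either side they give 1 - a^n, which tends to 1. *)
Lemma neumann a : nrm a < 1 -> invertible (1 - a).
Proof.
move=> a1; have a0 := nrm_ge0 hC a.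
have nX n : nrm (a ^+ n) <= nrm a ^+ n.
  elim: n => [|n IH]; first by rewrite !expr0 nrm1.
  by rewrite !exprS; apply: le_trans (nrm_submult hC _ _) _; rewrite ler_wpM2l.
pose u n := \sum_(i < n) a ^+ i.
have [|l cl] := @cvg_nrm_geom u 1 (nrm a) a0 a1.
  by move=> n; rewrite /u big_ord_recr /= mul1r [_ + a ^+ n]addrC addrK.
have cX : cvg_nrm (fun n => 1 - a ^+ n) 1.
  apply: (cvg_nrm_le (@cvg_nrm0_geom (fun n => a ^+ n) 1 (nrm a) a0 a1 _) ler01).
    by move=> n; rewrite mul1r.
  by move=> n; rewrite mul1r subr0 addrAC subrr add0r nrmN.
exists l; split.
  apply: (cvg_nrm_eq (cvg_nrmMl (1 - a) cl) cX) => n.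
  by rewrite -[1 - a]opprB mulNr -subrX1 opprB.
apply: (cvg_nrm_eq (cvg_nrmMr (1 - a) cl) cX) => n.
have -> : u n * (1 - a) = (1 - a) * u n.
  apply/commr_sym/commr_sum => i _; apply/commr_sym/commrB; first exact: commr1.
  exact/commr_sym/commrX.
by rewrite -[1 - a]opprB mulNr -subrX1 opprB.
Qed.

Lemma neumann_scaled a c : nrm a < c -> invertible (c *r 1 - a).
Proof.
move=> ac; have c0 : 0 < c by apply: le_lt_trans ac; exact: (nrm_ge0 hC).
have [|b [b1 b2]] := @neumann (c^-1 *r a).
  by rewrite nrmZr gtr0_norm ?invr_gt0 // mulrC ltr_pdivrMr // mul1r.
have e : c *r 1 - a = c *r (1 - c^-1 *r a).
  by rewrite scalerBr scalerA -rmorphM mulfV ?lt0r_neq0 // rmorph1 scale1r.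
exists (c^-1 *r b); rewrite e -!scalerAl -!scalerAr !scalerA b1 b2 -!rmorphM.
by rewrite mulfV ?mulVf ?lt0r_neq0 // rmorph1 scale1r.
Qed.

Lemma invertible_scale a c : c != 0 -> invertible a -> invertible (c *r a).
Proof.
move=> c0 [b [b1 b2]]; exists (c^-1 *r b).
rewrite -!scalerAl -!scalerAr !scalerA b1 b2 -!rmorphM.
by rewrite mulfV ?mulVf // rmorph1 scale1r.
Qed.

Lemma conjc_i : conjc 'i%C = - 'i%C :> R[i].
Proof. by apply/eqP; rewrite eq_complex /= oppr0 !eqxx. Qed.

(** Write 1 + j = (1 + m) - a with a = m - j and m = |j|^2 / 2. The C*-identity gives |a|^2 = |m^2 -
    j^2| <= m^2 + 2 m < (1 + m)^2, and the Neumann series applies. *)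
Lemma invertible_1D_skew j : star j = - j -> invertible (1 + j).
Proof.
move=> sj; set m := nrm j ^+ 2 / 2.
have j0 := nrm_ge0 hC j.
have m0 : 0 <= m by rewrite /m; nra.
pose a := m *r 1 - j.
have sa : star a = m *r 1 + j by rewrite starB starZr star1 sj opprK.
have na : nrm a ^+ 2 <= nrm j ^+ 2 + m ^+ 2.
  rewrite -(cstar_identity hC) sa.
  have -> : (m *r 1 + j) * (m *r 1 - j) = (m ^+ 2) *r 1 - j * j.
    rewrite mulrDl !mulrBr -!scalerAl -!scalerAr !scalerA !mul1r !mulr1 -rmorphM.
    by rewrite -expr2 addrA addrNK.
  apply: le_trans (nrm_triangle_sub _ _) _.
  have h := nrm_submult hC j j; rewrite nrmZr nrm1 mulr1 ger0_norm ?exprn_ge0 //.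
  by rewrite addrC lerD2r expr2.
have lt : nrm a < 1 + m.
  rewrite -(@ltr_pXn2r _ 2) ?nnegrE ?(nrm_ge0 hC) //; last by lra.
  apply: le_lt_trans na _; rewrite /m; nra.
have := neumann_scaled lt; congr invertible.
by rewrite /a rmorphD rmorph1 scalerDl scale1r opprB addrACA subrr addr0.
Qed.

Lemma invertible_1B_sqr_skew j : star j = - j -> invertible (1 - j * j).
Proof.
move=> sj; have -> : 1 - j * j = (1 + j) * (1 - j) by non_commutative_ring.
apply: invertibleM; first exact: invertible_1D_skew.
by apply: invertible_1D_skew; rewrite starN sj.
Qed.

(** The element j = i h / sqrt c is skew, and h^2 + c = c (1 - j^2). *)
Lemma invertible_sqrD h c : 0 < c -> star h = h -> invertible (h * h + c *r 1).
Proof.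
move=> c0 sh; set d := (Num.sqrt c)^-1.
have dd : d * d = c^-1 by rewrite /d -invfM -expr2 sqr_sqrtr // ltW.
pose j := (d%:C)%C *: ('i%C *: h).
have sj : star j = - j.
  by rewrite /j starZr (star_scale hC) sh -[in RHS]scalerN -scaleNr conjc_i.
have jj : - (j * j) = c^-1 *r (h * h).
  rewrite /j -!scalerAl -!scalerAr !scalerA -scaleNr; congr (_ *: _).
  by rewrite -dd rmorphM /=; simpc.
have := invertible_scale (lt0r_neq0 c0) (invertible_1B_sqr_skew sj).
rewrite jj scalerDr scalerA -rmorphM mulfV ?lt0r_neq0 // rmorph1 scale1r.
by rewrite addrC.
Qed.

Lemma half_double a : 2^-1 *r (a + a) = a.
Proof.
rewrite scalerDr -scalerDl -rmorphD; have -> : 2^-1 + 2^-1 = 1 :> R by lra.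
by rewrite rmorph1 scale1r.
Qed.

Lemma nrm_comm_sqrD a b : star a = a -> star b = b -> a * b = b * a ->
  nrm a ^+ 2 <= nrm (a * a + b * b).
Proof.
move=> sa sb ab; pose z := a + 'i%C *: b.
have sz : star z = a - 'i%C *: b.
  by rewrite (star_add hC) sa (star_scale hC) sb -scaleNr conjc_i.
have -> : a * a + b * b = star z * z.
  rewrite sz /z mulrBl !mulrDr -!scalerAl -!scalerAr !scalerA ab.
  have -> : ('i * 'i = -1 :> R[i])%C by simpc.
  by rewrite scaleN1r opprD opprK addrA addrK.
rewrite (cstar_identity hC) ler_pXn2r ?nnegrE ?(nrm_ge0 hC) //.
have -> : a = 2^-1 *r (z + star z).
  by rewrite sz /z addrACA subrr addr0 half_double.
rewrite nrmZr ger0_norm ?invr_ge0 //.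
by have := nrm_triangle hC z (star z); rewrite nrm_star; lra.
Qed.

End CStar.

(** * The sign of an invertible selfadjoint element *)

Section Sign.
Variables (R : realType) (A : algType R[i]) (star : A -> A) (nrm : A -> R).
Hypothesis hC : is_unital_cstar star nrm.
Implicit Types (a b x y h k s t : A) (r c : R).

Local Notation "r *r x" := ((r%:C)%C *: x) (at level 40).

(** This is [nrm_comm_sqrD] for the identity (2 a x)^2 + (x - a^2 x)^2 = ((1 + a^2) x)^2. *)
Lemma nrm_AMGM a x : star a = a -> star x = x -> a * x = x * a ->
  2 * nrm (a * x) <= nrm ((1 + a * a) * x).
Proof.
move=> sa sx ax; set b := (1 + a * a) * x.
have sax : star (a * x) = a * x by rewrite (star_mul hC) sa sx.
have saax : star (a * a * x) = a * a * x.
  by rewrite !(star_mul hC) sa sx mulrA -ax -!mulrA -ax.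
have sb : star b = b by rewrite /b mulrDl mul1r (star_add hC) sx saax.
have h1 : star (a * x + a * x) = a * x + a * x by rewrite (star_add hC) sax.
have h2 : star (x - a * a * x) = x - a * a * x by rewrite (starB hC) saax sx.
have e1 : (a * x + a * x) * (x - a * a * x) = (x - a * a * x) * (a * x + a * x).
  have cx : GRing.comm (a * x) x by rewrite /GRing.comm mulrA ax.
  have ca : GRing.comm (a * x) a by rewrite /GRing.comm -mulrA ax mulrA.
  have c : GRing.comm (a * x) (x - a * a * x).
    by apply: commrB => //; do 2!apply: commrM => //.
  by apply/commr_sym/commrD; apply/commr_sym.
have := nrm_comm_sqrD hC h1 h2 e1.
have -> : (a * x + a * x) * (a * x + a * x) + (x - a * a * x) * (x - a * a * x)
   = b * b.
  rewrite /b; have e z : z * x * a = z * a * x by rewrite -mulrA -ax mulrA.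
  have e' : x * a = a * x by [].
  rewrite !(mulrDl, mulrDr, mulrN, mulNr, mulrA, mul1r, mulr1) !e e' !e.
  by non_commutative_ring.
rewrite (nrm_sqr_sa hC sb) ler_pXn2r ?nnegrE ?(nrm_ge0 hC) //.
have -> : nrm (a * x + a * x) = 2 * nrm (a * x) => //.
by rewrite -[in RHS](half_double (a * x)) (nrmZr hC) ger0_norm ?invr_ge0 // mulVKf ?pnatr_eq0.
Qed.

(** The selfadjoint part of the bicommutant of [k]: its members commute with one another, so their
    products stay selfadjoint. *)
Definition sa_bicomm k x : Prop :=
  star x = x /\ forall z, GRing.comm k z -> GRing.comm x z.

Lemma sa_bicomm_comm k x y : sa_bicomm k x -> sa_bicomm k y -> x * y = y * x.
Proof. by move=> [_ hx] [_ hy]; apply: hx; apply/commr_sym/hy. Qed.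

Lemma sa_bicommM k x y : sa_bicomm k x -> sa_bicomm k y -> sa_bicomm k (x * y).
Proof.
move=> hx hy; split.
  by rewrite (star_mul hC) hx.1 hy.1 (sa_bicomm_comm hx hy).
by move=> z kz; apply/commr_sym/commrM; apply/commr_sym; [apply: hx.2 | apply: hy.2].
Qed.

Lemma sa_bicomm_sqrD1 k x : sa_bicomm k x -> sa_bicomm k (1 + x * x).
Proof.
move=> hx; have [s1 h1] := sa_bicommM hx hx; split.
  by rewrite (star_add hC) (star1 hC) s1.
by move=> z /h1 h; apply/commr_sym/commrD; [exact: commr1 | apply/commr_sym].
Qed.

Lemma sa_bicomm1 k : sa_bicomm k 1.
Proof. by split=> [|z _]; [exact: (star1 hC) | apply/commr_sym/commr1]. Qed.

(* With [K j = k ^ (2 ^ j)], the product of the [1 + K j], [1 <= j <= m], is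
   [(1 - k ^ 2)^-1 * (1 - K m.+1)], hence bounded, while by [nrm_AMGM] its norm
   is at least [2 ^ m * nrm (k ^ (2 ^ m - 1)) = 2 ^ m]. *)
Lemma not_invertible_1B_sqr k : star k = k -> nrm k = 1 -> ~ invertible (1 - k * k).
Proof.
move=> sk nk [g [_ gk]].
pose K := fix K n := if n is m.+1 then K m * K m else k.
pose P := fix P n := if n is m.+1 then P m * (1 + K n) else 1 : A.
pose Q := fix Q n := if n is m.+1 then Q m * K m else 1 : A.
have KS n : K n.+1 = K n * K n by [].
have PS n : P n.+1 = P n * (1 + K n.+1) by [].
have QS n : Q n.+1 = Q n * K n by [].
have bK n : sa_bicomm k (K n).
  elim: n => [|n IH] /=; first by split=> // z.
  exact: sa_bicommM.
have bQ n : sa_bicomm k (Q n).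
  by elim: n => [|n IH] /=; [exact: sa_bicomm1 | apply: sa_bicommM].
have nK n : nrm (K n) = 1.
  by elim: n => [//|n IH] /=; rewrite (nrm_sqr_sa hC (bK n).1) IH expr1n.
have Qk n : Q n * k = K n.
  elim: n => [|n IH] /=; first by rewrite mul1r.
  by rewrite -mulrA (sa_bicomm_comm (bK n) (bK 0%N)) mulrA IH.
have nQ n : 1 <= nrm (Q n).
  by have := nrm_submult hC (Q n) k; rewrite Qk nK nk mulr1.
have hP n : (1 - k * k) * P n = 1 - K n.+1.
  elim: n => [|n IH]; first by rewrite mulr1.
  by rewrite PS mulrA IH (KS n.+1); set z := K n.+1; non_commutative_ring.
(* The free factor [y] lets the induction absorb the last factor 1 + (K n)^2 of the product;
   [nrm_AMGM] then trades it for 2 [K n]. *)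
have PQ n y : sa_bicomm k y -> 2 ^+ n * nrm (Q n * y) <= nrm (P n * y).
  elim: n y => [|n IH] y by'; first by rewrite expr0 mul1r.
  rewrite PS -[P n * _ * y]mulrA KS.
  apply: le_trans (IH _ (sa_bicommM (sa_bicomm_sqrD1 (bK n)) by')).
  rewrite exprSr -mulrA ler_wpM2l ?exprn_ge0 // QS.
  have Qy := sa_bicommM (bQ n) by'.
  have := nrm_AMGM (bK n).1 Qy.1 (sa_bicomm_comm (bK n) Qy).
  rewrite !mulrA (sa_bicomm_comm (bK n) (bQ n)).
  by rewrite (sa_bicomm_comm (sa_bicomm_sqrD1 (bK n)) (bQ n)).
(* Since |1 - K m.+1| <= 2, the norm of [P m] is at most 2 |g|, which is less than m and hence than
   2^m. *)
pose m := Num.bound (2 * nrm g).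
have : (2 * nrm g) < m%:R.
  by apply: archi_boundP; rewrite mulr_ge0 ?(nrm_ge0 hC).
have : (m%:R : R) < 2 ^+ m by rewrite -natrX ltr_nat ltn_expl.
have := PQ m 1 (sa_bicomm1 k); rewrite !mulr1.
have -> : P m = g * (1 - K m.+1) by rewrite -hP mulrA gk mul1r.
have := nrm_submult hC g (1 - K m.+1).
have := nrm_triangle_sub hC 1 (K m.+1); rewrite nK (nrm1 hC).
have := nrm_ge0 hC g; have := nQ m; have : 0 <= 2 ^+ m :> R by rewrite exprn_ge0.
set X := 2 ^+ m; set N := m%:R; set G := nrm g; set H := nrm (1 - _).
set q := nrm (Q m); nra.
Qed.

(** Suppose x = c - h^2 has norm N >= c. Then k = x / N has norm 1, yet 1 - k and 1 + k are both
    invertible: N - x = h^2 + (N - c) is a square of an invertible or is covered by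
    [invertible_sqrD], and N + x = (N + c) - h^2 is a Neumann case. This contradicts
    [not_invertible_1B_sqr]. *)
Lemma nrm_lt_invertible h c : star h = h -> invertible h -> 0 < c ->
  nrm h ^+ 2 <= c -> nrm (c *r 1 - h * h) < c.
Proof.
move=> sh ih c0 hc; rewrite ltNge; apply/negP; set N := nrm _ => cN.
have N0 : 0 < N by apply: lt_le_trans cN.
pose k := N^-1 *r (c *r 1 - h * h).
have sk : star k = k.
  by rewrite (starZr hC) (starB hC) (starZr hC) (star1 hC) (star_mul hC) sh.
have nk : nrm k = 1.
  by rewrite (nrmZr hC) ger0_norm ?invr_ge0 ?(ltW N0) // mulVf ?lt0r_neq0.
apply: (not_invertible_1B_sqr sk nk).
have one : 1 = N^-1 *r (N *r 1) :> A.
  by rewrite scalerA -rmorphM mulVf ?lt0r_neq0 // rmorph1 scale1r.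
have -> : 1 - k * k = (1 - k) * (1 + k) by non_commutative_ring.
have iN : N^-1 != 0 by rewrite invr_neq0 // lt0r_neq0.
apply: invertibleM; rewrite one -?scalerBr -?scalerDr; apply: invertible_scale => //.
  have -> : N *r 1 - (c *r 1 - h * h) = h * h + (N - c) *r 1.
    by rewrite rmorphB scalerBl opprB [RHS]addrC addrA addrAC.
  move: cN; rewrite le_eqVlt => /orP [/eqP <-|cN].
    by rewrite subrr scale0r addr0; apply: invertibleM.
  by apply: (invertible_sqrD hC) => //; rewrite subr_gt0.
rewrite addrA -scalerDl -rmorphD; apply: (neumann_scaled hC).
by rewrite (nrm_sqr_sa hC sh); lra.
Qed.

(** Every Newton iterate is an odd real polynomial in [h]. If [h] swaps [p] and [q], its square
    commutes with both, so each iterate swaps them as well, and the relation passes to the limit. *)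
Lemma sign_exists h : star h = h -> invertible h ->
  exists s, [/\ star s = s, s * s = 1 &
    forall p q, h * p = q * h -> h * q = p * h -> s * p = q * s].
Proof.
(* The start is h / sqrt M, whose defect has norm less than 1 by [nrm_lt_invertible]; the added 1
   makes [M] positive outright. *)
move=> sh ih; set M := nrm h ^+ 2 + 1.
have M0 : 0 < M by have := sqr_ge0 (nrm h); rewrite /M; lra.
have := nrm_lt_invertible sh ih M0; rewrite /M => /(_ _); rewrite lerDl ler01 -/M.
move=> /(_ isT) ltM; set mu := (Num.sqrt M)^-1.
have mumu : mu * mu = M^-1 by rewrite /mu -invfM -expr2 sqr_sqrtr // ltW.
pose s0 := mu *r h.
pose rho := nrm (1 - s0 * s0).
have rho1 : rho < 1.
  rewrite /rho; have -> : 1 - s0 * s0 = M^-1 *r (M *r 1 - h * h).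
    rewrite /s0 -!scalerAl -!scalerAr !scalerA -rmorphM mumu scalerBr scalerA.
    by rewrite -rmorphM mulVf ?lt0r_neq0 // rmorph1 scale1r.
  by rewrite (nrmZr hC) ger0_norm ?invr_ge0 ?(ltW M0) // mulrC ltr_pdivrMr ?mul1r.
have rho0 : 0 <= rho by exact: (nrm_ge0 hC).
(* Newton's step s (3 - s^2) / 2, written through the defect e = 1 - s^2; the new defect is 3/4 e^2
   + 1/4 e^3. *)
pose nw s := s * (1 + 2^-1 *r (1 - s * s)).
pose u n := iter n nw s0.
have uS n : u n.+1 = u n * (1 + 2^-1 *r (1 - u n * u n)) by [].
have su n : star (u n) = u n.
  elim: n => [|n IH]; first by rewrite /u /s0 /= (starZr hC) sh.
  rewrite uS (star_mul hC) (star_add hC) (starZr hC) (starB hC) (star1 hC).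
  rewrite (star_mul hC) IH mulrDl mulrDr mul1r mulr1 -scalerAl -scalerAr.
  by rewrite mulrBl mulrBr mul1r mulr1 mulrA.
have eS n : nrm (1 - u n.+1 * u n.+1) <= 3 / 4 * nrm (1 - u n * u n) ^+ 2
     + 1 / 4 * nrm (1 - u n * u n) ^+ 3.
  set e := 1 - u n * u n; set a := 2^-1 *r e.
  have ea : e = a + a by rewrite /a -scalerDr half_double.
  have au : a * u n = u n * a.
    by rewrite /a /e -scalerAl -scalerAr mulrBl mulrBr mul1r mulr1 mulrA.
  have uu : u n * u n = 1 - (a + a) by rewrite -ea /e subKr.
  have -> : 1 - u n.+1 * u n.+1 = a * a + a * a + a * a + (a * a * a + a * a * a).
    rewrite uS -/e -/a.
    have -> : u n * (1 + a) * (u n * (1 + a)) = u n * u n * (1 + a) * (1 + a).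
      rewrite !(mulrDl, mulrDr, mulr1, mul1r, mulrA).
      by rewrite -![u n * a * u n]mulrA au !mulrA.
    by rewrite uu; non_commutative_ring.
  have na : nrm a = nrm e / 2.
    by rewrite /a (nrmZr hC) ger0_norm ?invr_ge0 // mulrC.
  have aa : nrm (a * a) <= nrm a ^+ 2 by rewrite expr2; apply: (nrm_submult hC).
  have aaa : nrm (a * a * a) <= nrm a ^+ 3.
    rewrite exprSr; apply: le_trans (nrm_submult hC _ _) _.
    by rewrite ler_wpM2r ?(nrm_ge0 hC).
  have t1 := nrm_triangle hC (a * a) (a * a).
  have t2 := nrm_triangle hC (a * a + a * a) (a * a).
  have t3 := nrm_triangle hC (a * a * a) (a * a * a).
  apply: le_trans (nrm_triangle hC _ _) _.
  have -> : 3 / 4 * nrm e ^+ 2 = 3 * nrm a ^+ 2 by rewrite na; field.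
  have -> : 1 / 4 * nrm e ^+ 3 = 2 * nrm a ^+ 3 by rewrite na; field.
  by lra.
(* The decay is quadratic, but the ratio [rho] is enough for [cvg_nrm_geom]: for E <= 1 the bound in
   [eS] is at most E^2, and one factor E is at most [rho]. *)
have en n : nrm (1 - u n * u n) <= rho * rho ^+ n.
  elim: n => [|n IH]; first by rewrite mulr1.
  apply: le_trans (eS n) _; rewrite [rho ^+ _]exprSr.
  have le : rho * rho ^+ n <= rho.
    by rewrite -[leRHS]mulr1 ler_wpM2l // exprn_ile1 // ltW.
  have ge : 0 <= rho ^+ n by exact: exprn_ge0.
  move: IH (nrm_ge0 hC (1 - u n * u n)); set E := nrm _ => IH E0.
  have E1 : E <= 1 by apply: le_trans IH (le_trans le (ltW rho1)).
  have : E ^+ 2 <= rho * rho ^+ n * rho.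
    by rewrite expr2; apply: ler_pM => //; apply: le_trans IH le.
  have : E ^+ 3 <= E ^+ 2 by rewrite exprSr ler_piMr // exprn_ge0.
  by rewrite mulrA; set X := rho * _ * rho; lra.
(* This bound cancels the factor 1/2 in the increment of the iteration, and also serves for the
   limit of [u n * u n]. *)
have nu n : nrm (u n) <= 2.
  have h2 : nrm (u n) ^+ 2 <= 2.
    rewrite -(nrm_sqr_sa hC (su n)).
    have -> : u n * u n = 1 - (1 - u n * u n) by rewrite subKr.
    apply: le_trans (nrm_triangle_sub hC _ _) _; rewrite (nrm1 hC).
    have : rho * rho ^+ n <= 1.
      by rewrite -exprS exprn_ile1 // ltW.
    by move=> r1; have := le_trans (en n) r1; lra.
  by rewrite -(@ler_pXn2r _ 2) ?nnegrE ?(nrm_ge0 hC) //; apply: le_trans h2 _; lra.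
have [|s cs] := cvg_nrm_geom hC (u := u) (C := rho) rho0 rho1.
  move=> n; rewrite uS mulrDr mulr1 addrAC subrr add0r.
  apply: le_trans (nrm_submult hC _ _) _.
  rewrite (nrmZr hC) ger0_norm ?invr_ge0 //.
  by have := nu n; have := en n; have := nrm_ge0 hC (u n); have := nrm_ge0 hC (1 - u n * u n);
    move: (nrm (u n)) (nrm (1 - _)) (rho * _) => X Y Z; clear; nra.
exists s; split.
- by apply: (cvg_nrm_eq hC (cvg_nrm_star hC cs) cs) => n; rewrite su.
- have c1 : cvg_nrm nrm (fun n => u n * u n) 1.
    have c0 := cvg_nrm0_geom hC (u := fun n => 1 - u n * u n) rho0 rho1 en.
    apply: (cvg_nrm_le hC c0 ler01) => n.
    by rewrite mul1r subr0 (nrm_subC hC).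
  by apply: (cvg_nrm_eq hC (cvg_nrmM hC nu cs cs) c1).
move=> p q hp hq.
have pq n : u n * p = q * u n /\ u n * q = p * u n.
  elim: n => [|n [IH1 IH2]].
    by rewrite /u /s0 /= -!scalerAl -!scalerAr hp hq.
  have up : u n * u n * p = p * (u n * u n) by rewrite -mulrA IH1 mulrA IH2 mulrA.
  have uq : u n * u n * q = q * (u n * u n) by rewrite -mulrA IH2 mulrA IH1 mulrA.
  have c x : u n * u n * x = x * (u n * u n) ->
      (1 + 2^-1 *r (1 - u n * u n)) * x = x * (1 + 2^-1 *r (1 - u n * u n)).
    by move=> h1; rewrite mulrDl mulrDr mulr1 mul1r -scalerAl -scalerAr
      mulrBl mulrBr mul1r mulr1 h1.
  by rewrite uS -!mulrA (c p up) (c q uq) !mulrA IH1 IH2.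
apply: (cvg_nrm_eq hC (cvg_nrmMr hC p cs) (cvg_nrmMl hC q cs)) => n.
exact: (pq n).1.
Qed.

End Sign.

(** * Murray-von Neumann equivalence and range projections *)

Section Projections.
Variables (R : realType) (A : algType R[i]) (star : A -> A) (nrm : A -> R).
Variable F : A -> Prop.
Hypothesis hC : is_unital_cstar star nrm.
Hypothesis hF : finite_type_algebra star nrm F.
Implicit Types (a b f p q s t v x y z : A).

Lemma mvn_equiv_refl p : is_proj star p -> mvn_equiv star p p.
Proof. by case=> pp sp; exists p; rewrite sp. Qed.

Lemma mvn_equiv_trans p q r : is_proj star p -> is_proj star r ->
  mvn_equiv star p q -> mvn_equiv star q r -> mvn_equiv star p r.
Proof.
move=> [pp _] [rr _] [v [vp vq]] [w [wq wr]]; exists (v * w).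
rewrite (star_mul hC); split.
  by rewrite mulrA -(mulrA v) wq -vq !mulrA vp -mulrA vp.
by rewrite mulrA -(mulrA (star w)) vq -wq !mulrA wr -mulrA wr.
Qed.

(** With x in sAt and y in tAs, h = x + x^* + (1 - s - t) is selfadjoint with inverse y + y^* + (1 -
    s - t) and swaps s and t. Its sign g is a selfadjoint unitary that swaps them too, so s g is the
    required partial isometry. *)
Lemma orth_iso_mvn_equiv s t x y : is_proj star s -> is_proj star t ->
  t * s = 0 -> x * y = s -> y * x = t -> mvn_equiv star s t.
Proof.
move=> [ss s_] [tt t_] ts.
have st : s * t = 0 by rewrite -s_ -t_ -(star_mul hC) ts (star0 hC).
(* The compressions s x t and t y s still multiply to s and t, so x, and next y, may be taken in its
   corner. *)
wlog [sx xt] : x y / s * x = x /\ x * t = x => [hw xy yx|].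
  apply: (hw (s * x * t) (t * y * s)).
  - by rewrite !mulrA ss -!mulrA tt.
  - by rewrite !mulrA -[_ * t * t]mulrA tt -yx !mulrA -[s * x * y]mulrA xy ss
      -!mulrA !(mulrA x y) xy !mulrA !ss.
  - by rewrite !mulrA -[_ * s * s]mulrA ss -xy !mulrA -[t * y * x]mulrA yx tt
      -!mulrA !(mulrA y x) yx !mulrA !tt.
wlog [ty ys] : y / t * y = y /\ y * s = y => [hw xy yx|xy yx].
  apply: (hw (t * y * s)).
  - by rewrite !mulrA tt -!mulrA ss.
  - by rewrite !mulrA xt xy ss.
  - by rewrite -!mulrA sx yx tt.
have txs : t * star x = star x by rewrite -{1}t_ -(star_mul hC) xt.
have xss : star x * s = star x by rewrite -{1}s_ -(star_mul hC) sx.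
have syt : s * star y = star y by rewrite -{1}s_ -(star_mul hC) ys.
have ytt : star y * t = star y by rewrite -{1}t_ -(star_mul hC) ty.
have ysx : star y * star x = s by rewrite -(star_mul hC) xy s_.
have xsy : star x * star y = t by rewrite -(star_mul hC) yx t_.
have xs : x * s = 0 by rewrite -xt -mulrA ts mulr0.
have tx : t * x = 0 by rewrite -sx mulrA ts mul0r.
have yt : y * t = 0 by rewrite -ys -mulrA st mulr0.
have sy : s * y = 0 by rewrite -ty mulrA st mul0r.
have sxs : s * star x = 0 by rewrite -txs mulrA st mul0r.
have xst : star x * t = 0 by rewrite -xss -mulrA st mulr0.
have tys : t * star y = 0 by rewrite -syt mulrA ts mul0r.
have yss : star y * s = 0 by rewrite -ytt -mulrA ts mulr0.
have xys : x * star y = 0 by rewrite -syt mulrA xs mul0r.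
have ysx' : star y * x = 0 by rewrite -sx mulrA yss mul0r.
have xsy' : star x * y = 0 by rewrite -ty mulrA xst mul0r.
have yxs : y * star x = 0 by rewrite -txs mulrA yt mul0r.
pose h := x + star x + (1 - s - t).
have sh : star h = h.
  by rewrite /h !(starB hC, star_add hC) (star_invol hC) (star1 hC) s_ t_ [star x + x]addrC.
have ih : invertible h.
  exists (y + star y + (1 - s - t)); rewrite /h; split.
    rewrite !(mulrDl, mulrDr, mulrN, mulNr, mulr1, mul1r).
    rewrite xy xys xsy' xsy xs xt xss xst sy syt ty tys ss tt st ts.
    by non_commutative_ring.
  rewrite !(mulrDl, mulrDr, mulrN, mulNr, mulr1, mul1r).
  rewrite yx ysx ysx' yxs ys yt yss ytt sx sxs tx txs ss tt st ts.
  by non_commutative_ring.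
have hs : h * s = t * h.
  rewrite /h !(mulrDl, mulrDr, mulrN, mulNr, mulr1, mul1r) xs xss ss ts tx txs tt.
  by non_commutative_ring.
have ht : h * t = s * h.
  rewrite /h !(mulrDl, mulrDr, mulrN, mulNr, mulr1, mul1r) xt xst st tt sx sxs ss.
  by non_commutative_ring.
have [g [sg gg gst]] := sign_exists hC sh ih.
have gs := gst _ _ hs ht; have gt := gst _ _ ht hs.
exists (s * g); rewrite (star_mul hC) sg s_; split.
  by rewrite mulrA -[_ * g * g]mulrA gg mulr1 ss.
by rewrite mulrA -[_ * s * s]mulrA ss gs -mulrA gg mulr1.
Qed.

(** Condition (iii) does not say that [star v * v] lies in [F]; this follows from q v = v. For w = q
    v - v one computes w w^* = 0, and the C*-identity gives w = 0. *)
Lemma projF_orth p q : projF star F p -> projF star F q ->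
  exists v, [/\ v * star v = q, projF star F (star v * v),
    star v * v * p = 0 & q * v = v].
Proof.
move=> hp hq; have [v [vq vp]] := fta_orth hF hp hq.
case: hq => [Fq [qq q_]].
have qv : q * v = v.
  apply/eqP; rewrite -subr_eq0; apply/eqP.
  have : (q * v - v) * star (q * v - v) = 0.
    rewrite (starB hC) (star_mul hC) q_ mulrBl !mulrBr !mulrA.
    by rewrite -!(mulrA q v) !vq !qq !subrr.
  set w := q * v - v => w0; rewrite -(star_invol hC w).
  apply: (etrans _ (star0 hC)); congr star; apply: (nrm_eq0 hC).
  have := cstar_identity hC (star w); rewrite (star_invol hC) w0 (nrm0 hC) => /esym/eqP.
  by rewrite expf_eq0 => /eqP.
have vvv : star v * v * star v * v = star v * v.
  by rewrite -(mulrA (star v)) vq -mulrA qv.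
exists v; split=> //; split; last split.
- by rewrite -qv mulrA; apply/(fta_mulr hF)/(fta_mull hF).
- by rewrite mulrA.
- by rewrite (star_mul hC) (star_invol hC).
Qed.

(** Condition (iii) supplies a copy v^* v of [t] orthogonal to [s]. The isomorphism is carried along
    [v], the orthogonal case applies, and [star v] leads back to [t]. *)
Lemma projF_iso_mvn_equiv s t x y : projF star F s -> projF star F t ->
  x * y = s -> y * x = t -> mvn_equiv star s t.
Proof.
move=> hs ht xy yx; have [v [vt ht' vs tv]] := projF_orth hs ht.
have [[_ ps] [_ pt]] := (hs, ht); have [_ pt'] := ht'.
apply: (mvn_equiv_trans ps pt (q := star v * v)); last first.
  by exists (star v); rewrite (star_invol hC).
apply: (@orth_iso_mvn_equiv _ _ (s * x * v) (star v * y)) => //.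
  rewrite -!mulrA (mulrA v) vt -yx !mulrA -[s * x * y]mulrA xy ps.1.
  by rewrite -mulrA xy ps.1.
have ysx : y * s * x = t by rewrite -xy !mulrA yx -mulrA yx pt.1.
by rewrite !mulrA -(mulrA (star v) y) -(mulrA (star v)) ysx -mulrA tv.
Qed.

Lemma range_projF f : F f -> f * f = f ->
  exists p, [/\ projF star F p, p * f = f & f * p = p].
Proof.
move=> Ff ff; set u := f + star f - 1; set fs := star f.
have fsfs : fs * fs = fs by rewrite /fs -(star_mul hC) ff.
have fu : f * u = f * fs.
  by rewrite /u -/fs !(mulrDr, mulrN, mulr1) ff addrAC subrr add0r.
have ufs : u * fs = f * fs.
  by rewrite /u -/fs !(mulrDl, mulNr, mul1r) fsfs addrK.
have fsu : fs * u = fs * f.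
  by rewrite /u -/fs !(mulrDr, mulrN, mulr1) fsfs addrK.
have uf : u * f = fs * f.
  by rewrite /u -/fs !(mulrDl, mulNr, mul1r) ff addrAC subrr add0r.
have [w [uw wu]] : invertible u.
  apply: (@invertible_comm_factor _ u u) => //.
  have -> : u * u = 1 - (f - fs) * (f - fs).
    rewrite {1}/u -/fs mulrBl mulrDl fu fsu mul1r !(mulrBl, mulrBr) ff fsfs /u -/fs.
    by non_commutative_ring.
  apply: (invertible_1B_sqr_skew hC).
  by rewrite (starB hC) (star_invol hC) opprB.
have sw : star w = w.
  have su : star u = u.
    by rewrite /u (starB hC) (star_add hC) (star_invol hC) (star1 hC) [star f + f]addrC.
  by rewrite -[LHS]mulr1 -uw mulrA -{1}su -(star_mul hC) uw (star1 hC) mul1r.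
have wf : w * f = fs * w.
  by rewrite -[LHS]mulr1 -uw !mulrA -(mulrA w f) fu -ufs !mulrA wu mul1r.
have fw : f * w = w * fs.
  by rewrite -[LHS]mul1r -wu -!mulrA (mulrA u) uf -fsu -!mulrA uw mulr1.
have pf : f * w * f = f by rewrite -mulrA wf mulrA -fu -mulrA uw mulr1.
exists (f * w); split=> //; last by rewrite mulrA ff.
split; first exact: (fta_mulr hF).
split; first by rewrite mulrA pf.
by rewrite (star_mul hC) sw -/fs fw.
Qed.

(** * Fredholm type as invertibility modulo the ideal *)

Lemma projF_absorb f : F f -> exists q, projF star F q /\ nrm (f - q * f) < 1.
Proof.
move=> Ff; have [I [le [p [dir [hp happ]]]]] := fta_approx_unit hF.
have [i0 hi] := happ _ Ff _ ltr01.
by exists (p i0); split=> //; apply: (hi _ (directed_refl dir i0)).1.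
Qed.

Lemma fta_opp f : F f -> F (- f).
Proof. by move=> Ff; rewrite -scaleN1r; apply: (fta_scale hF). Qed.

Lemma fta_sub f g : F f -> F g -> F (f - g).
Proof. by move=> Ff Fg; apply: (fta_add hF) => //; apply: fta_opp. Qed.

(** Choose q so that z = (1 - q) (1 - t b) has norm less than 1, and let c invert 1 - z. Then (1 -
    q) t b c = 1 - q, so b' = b c (1 - q) is a right inverse of (1 - q) t. The idempotent g = 1 - b'
    (1 - q) t projects onto the kernel of (1 - q) t, and p is its range projection. *)
Lemma parametrix_fredholm t b : F (1 - t * b) -> F (1 - b * t) ->
  fredholm_type star F t.
Proof.
move=> Ftb Fbt; set f := 1 - t * b in Ftb.
have [q [hq nq]] := projF_absorb Ftb; have [Fq [qq q_]] := hq.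
set z := f - q * f in nq; have qz : q * z = 0 by rewrite /z mulrBr mulrA qq subrr.
have [c [zc cz]] := neumann hC nq.
have qc : q * c = q.
  by rewrite -[RHS]mulr1 -zc mulrA mulrBr mulr1 qz subr0.
have Fz : F z by apply: fta_sub => //; apply: (fta_mulr hF).
have Fc : F (1 - c).
  have -> : 1 - c = - (z * c) by rewrite -[in LHS]zc mulrBl mul1r addrAC subrr add0r.
  by apply/fta_opp/(fta_mulr hF).
pose b' := b * c * (1 - q).
have e1 : (1 - q) * (1 - q) = 1 - q by rewrite mulrBl mul1r mulrBr mulr1 qq subrr subr0.
have tb : t * b = 1 - f by rewrite /f subKr.
have qtb : (1 - q) * (t * b) = (1 - z) - q.
  by rewrite tb /z; non_commutative_ring.
have tb' : (1 - q) * t * b' = 1 - q.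
  rewrite /b' !mulrA -(mulrA _ t) qtb.
  by rewrite [_ * c]mulrBl zc qc e1.
pose g := 1 - b' * ((1 - q) * t).
have gg : g * g = g.
  have : b' * ((1 - q) * t) * (b' * ((1 - q) * t)) = b' * ((1 - q) * t).
    rewrite [LHS]mulrA -(mulrA b' _ b') tb' -(mulrA b' (1 - q)).
    by rewrite (mulrA (1 - q)) e1.
  rewrite /g; move: (b' * _) => e ee.
  by rewrite mulrBl mul1r mulrBr mulr1 ee subrr subr0.
(* Modulo [F], c is 1 and q is 0, so g agrees with 1 - b t. *)
have Fg : F g.
  have -> : g = (1 - b * t) + b * (1 - c) * t + b * c * q * t + b' * q * t.
    by rewrite /g /b'; non_commutative_ring.
  by do !apply: (fta_add hF) => //; apply: (fta_mulr hF) => //;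
     [apply: (fta_mull hF) | apply: (fta_mull hF) | apply: (fta_mull hF)].
have [p [hp pg gp]] := range_projF Fg gg; have [Fp [pp p_]] := hp.
have b'q : b' * (1 - q) = b' by rewrite /b' -mulrA e1.
have tg : (1 - q) * t * g = 0.
  by rewrite /g mulrBr mulr1 mulrA tb' mulrA e1 subrr.
have tp : (1 - q) * t * (1 - p) = (1 - q) * t.
  by rewrite mulrBr mulr1 -gp mulrA tg mul0r subr0.
have e2 : (1 - p) * (1 - p) = 1 - p by rewrite mulrBl mul1r mulrBr mulr1 pp subrr subr0.
exists p, q; split=> //; split=> //; exists ((1 - p) * b').
split; first by rewrite (mulrA (1 - p) (1 - p)) e2 -mulrA b'q.
split; first by rewrite (mulrA _ (1 - p) b') -(mulrA _ (1 - p) (1 - p)) e2 tp tb'.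
rewrite -(mulrA _ (1 - q) t) -(mulrA (1 - p) b').
have -> : b' * ((1 - q) * t) = 1 - g by rewrite /g subKr.
have pg0 : (1 - p) * g = 0 by rewrite mulrBl mul1r pg subrr.
by rewrite [(1 - p) * (1 - g)]mulrBr mulr1 pg0 subr0 e2.
Qed.

Lemma fredholm_parametrix t : fredholm_type star F t ->
  exists b, F (1 - t * b) /\ F (1 - b * t).
Proof.
move=> [p [q [[Fp _] [[Fq _] [b [hb [tb bt]]]]]]].
exists ((1 - p) * b * (1 - q)); split.
  have -> : 1 - t * ((1 - p) * b * (1 - q)) = (1 - (1 - q) * t * (1 - p) * b)
     + t * (1 - p) * b * q - q * t * (1 - p) * b by non_commutative_ring.
  rewrite tb subKr; apply: fta_sub; last by rewrite -!mulrA; apply: (fta_mulr hF).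
  by apply: (fta_add hF) => //; apply: (fta_mull hF).
have -> : 1 - (1 - p) * b * (1 - q) * t = (1 - b * (1 - q) * t * (1 - p))
     + p * b * (1 - q) * t - b * (1 - q) * t * p by non_commutative_ring.
rewrite bt subKr; apply: fta_sub; last by apply: (fta_mull hF).
by apply: (fta_add hF) => //; rewrite -!mulrA; apply: (fta_mulr hF).
Qed.

Lemma fredholm_type_mul t1 t2 : fredholm_type star F t1 ->
  fredholm_type star F t2 -> fredholm_type star F (t1 * t2).
Proof.
move=> /fredholm_parametrix [b1 [h1 h1']] /fredholm_parametrix [b2 [h2 h2']].
apply: (@parametrix_fredholm _ (b2 * b1)).
  have -> : 1 - t1 * t2 * (b2 * b1) = (1 - t1 * b1) + t1 * (1 - t2 * b2) * b1.
    by non_commutative_ring.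
  by apply: (fta_add hF) => //; apply/(fta_mulr hF)/(fta_mull hF).
have -> : 1 - b2 * b1 * (t1 * t2) = (1 - b2 * t2) + b2 * (1 - b1 * t1) * t2.
  by non_commutative_ring.
by apply: (fta_add hF) => //; apply/(fta_mulr hF)/(fta_mull hF).
Qed.

End Projections.

(** * Explicit 3 by 3 matrices over a noncommutative ring *)

Section Matrices.
Variable A : nzRingType.
Implicit Types a b p q t : A.

Definition mx3 a b c d e f g h i : 'M[A]_3 :=
  \matrix_(k, l) nth 0 (nth [::] [:: [:: a; b; c]; [:: d; e; f]; [:: g; h; i]] k) l.
Definition col3 (s : seq A) : 'M[A]_(3, 1) := \matrix_(k, l) nth 0 s k.
Definition row3 (s : seq A) : 'M[A]_(1, 3) := \matrix_(k, l) nth 0 s l.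

Lemma ord3_ind (P : 'I_3 -> Prop) :
  P 0 -> P 1 -> P 2 -> forall i, P i.
Proof.
move=> h0 h1 h2 [[|[|[|i]]] hi] //.
- by rewrite (_ : Ordinal hi = 0) //; apply: val_inj.
- by rewrite (_ : Ordinal hi = 1) //; apply: val_inj.
- by rewrite (_ : Ordinal hi = 2) //; apply: val_inj.
Qed.

Lemma mulmx3 a b c d e f g h i a' b' c' d' e' f' g' h' i' :
  mx3 a b c d e f g h i *m mx3 a' b' c' d' e' f' g' h' i' =
  mx3
    (a * a' + b * d' + c * g') (a * b' + b * e' + c * h') (a * c' + b * f' + c * i')
    (d * a' + e * d' + f * g') (d * b' + e * e' + f * h') (d * c' + e * f' + f * i')
    (g * a' + h * d' + i * g') (g * b' + h * e' + i * h') (g * c' + h * f' + i * i').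
Proof.
apply/matrixP => x y; rewrite !mxE !big_ord_recl big_ord0 !mxE addr0 addrA.
by elim/ord3_ind: x; elim/ord3_ind: y.
Qed.

Lemma mul_col3_row3 a b c a' b' c' :
  col3 [:: a; b; c] *m row3 [:: a'; b'; c'] =
  mx3 (a * a') (a * b') (a * c') (b * a') (b * b') (b * c')
    (c * a') (c * b') (c * c').
Proof.
apply/matrixP => x y; rewrite !mxE big_ord1 !mxE.
by elim/ord3_ind: x; elim/ord3_ind: y.
Qed.

Lemma mul_row3_col3 a b c a' b' c' :
  (row3 [:: a; b; c] *m col3 [:: a'; b'; c']) 0 0 = a * a' + b * b' + c * c'.
Proof. by rewrite mxE !big_ord_recl big_ord0 !mxE addr0 addrA. Qed.

Lemma mulmx11 (m n : 'M[A]_1) : (m *m n) 0 0 = m 0 0 * n 0 0.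
Proof. by rewrite mxE big_ord1. Qed.

Definition diag3 a b c := mx3 a 0 0 0 b 0 0 0 c.

Lemma subr_diag3 a b c a' b' c' :
  diag3 a b c - diag3 a' b' c' = diag3 (a - a') (b - b') (c - c').
Proof.
apply/matrixP => x y; rewrite !mxE.
by elim/ord3_ind: x; elim/ord3_ind: y; rewrite ?subrr.
Qed.

End Matrices.

(* If [S] is an isomorphism from [e] to [f] whose corner from [e1] to [f1] is
   invertible, then its Schur complement is one from [e - e1] to [f - f1]. *)
Lemma schur_complement_iso (B : nzRingType) (e f e1 f1 S T D : B) :
  T * S = e -> S * T = f -> f * S = S -> S * e = S ->
  f1 * S * D = f1 -> D * S * e1 = e1 -> D * f1 = D -> e1 * D = D ->
  e * e1 = e1 -> e1 * e = e1 -> f * f1 = f1 -> f1 * f = f1 ->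
  e1 * e1 = e1 -> f1 * f1 = f1 -> e * e = e -> f * f = f ->
  exists X Y, [/\ X * Y = f - f1, Y * X = e - e1,
    (e - e1) * Y = Y & Y * (f - f1) = Y].
Proof.
move=> TS ST fS Se fSD DSe Df eD ee1 e1e ff1 f1f e11 f11 ee ff.
(* The first witness is killed by [f1] on the left and by [e1] on the right; its inverse is the
   compression of [T] to the complementary corner. *)
exists (S - S * D * S), ((e - e1) * T * (f - f1)).
have fX : (f - f1) * (S - S * D * S) = S - S * D * S.
  rewrite !(mulrBl, mulrBr) !mulrA fS fSD; by non_commutative_ring.
have Xe : (S - S * D * S) * (e - e1) = S - S * D * S.
  rewrite !(mulrBl, mulrBr) -(mulrA (S * D) S e) Se.
  by rewrite -2!(mulrA S) DSe; non_commutative_ring.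
have e22 : (e - e1) * (e - e1) = e - e1.
  by rewrite !(mulrBl, mulrBr) ee ee1 e1e e11; non_commutative_ring.
have f22 : (f - f1) * (f - f1) = f - f1.
  by rewrite !(mulrBl, mulrBr) ff ff1 f1f f11; non_commutative_ring.
have Df' : D * f = D by rewrite -[in LHS]Df -mulrA f1f.
have eD' : e * D = D by rewrite -[in LHS]eD mulrA ee1.
have XT : (S - S * D * S) * T = f - S * D.
  by rewrite mulrBl -(mulrA _ S T) ST -(mulrA S D f) Df'.
have TX : T * (S - S * D * S) = e - D * S by rewrite mulrBr !mulrA TS eD'.
split.
- rewrite !mulrA Xe XT !(mulrBl, mulrBr) ff ff1 -!(mulrA S D) Df' Df.
  by non_commutative_ring.
- rewrite -(mulrA _ (f - f1)) fX -mulrA TX !(mulrBl, mulrBr) ee e1e !mulrA eD' eD.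
  by non_commutative_ring.
- by rewrite !mulrA e22.
- by rewrite -mulrA f22.
Qed.

(** * Dilations to isomorphisms and their Schur complement *)

Section IndexMatrices.
Variables (R : realType) (A : algType R[i]).
Implicit Types p q t : A.

Lemma inv_up_toP t p q : p * p = p -> q * q = q -> inv_up_to t p q ->
  exists b, [/\ p * b = 0, b * q = 0, (1 - q) * t * b = 1 - q &
    b * t * (1 - p) = 1 - p].
Proof.
move=> pp qq [b [hb [tb bt]]]; exists b.
have pb : p * b = 0.
  by rewrite hb !mulrA [p * (1 - p)]mulrBr mulr1 pp subrr !mul0r.
have bq : b * q = 0.
  by rewrite hb -!mulrA [(1 - q) * q]mulrBl mul1r qq subrr !mulr0.
split=> //.
  by rewrite -[RHS]tb -(mulrA _ (1 - p) b) [(1 - p) * b]mulrBl mul1r pb subr0.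
by rewrite -[RHS]bt [b * (1 - q)]mulrBr mulr1 bq subr0.
Qed.

(* In terms of maps between direct sums of right ideals, this says that
   [[t, q], [p, 0]] is an isomorphism from A + qA to A + pA with inverse
   [[b, (1 - b t) p], [q (1 - t b), - q t (1 - b t) p]]. *)
Lemma inv_up_to_dilation t p q : p * p = p -> q * q = q -> inv_up_to t p q ->
  exists b n12 n21 n22 : A,
   [/\ t * b + q * n21 = 1, t * n12 + q * n22 = 0, p * b = 0 & p * n12 = p] /\
   [/\ b * t + n12 * p = 1, b * q = 0, n21 * t + n22 * p = 0 & n21 * q = q] /\
   q * n21 = n21.
Proof.
move=> pp qq /(inv_up_toP pp qq) [b [pb bq tb bt]].
exists b, ((1 - b * t) * p), (q * (1 - t * b)), (- (q * t * (1 - b * t) * p)).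
split; [split | split; [split | ]].
- rewrite mulrA qq.
  have -> : t * b + q * (1 - t * b) = (1 - q) * t * b + q by non_commutative_ring.
  by rewrite tb subrK.
- rewrite mulrN !mulrA qq.
  have -> : t * (1 - b * t) * p - q * t * (1 - b * t) * p =
    ((1 - q) * t - (1 - q) * t * b * t) * p by non_commutative_ring.
  by rewrite tb subrr mul0r.
- exact: pb.
- by rewrite mulrA mulrBr mulr1 mulrA pb mul0r subr0 pp.
- rewrite -mulrA pp.
  have -> : b * t + (1 - b * t) * p = b * t * (1 - p) + p by non_commutative_ring.
  by rewrite bt subrK.
- exact: bq.
- rewrite mulNr -(mulrA _ p p) pp.
  have -> : q * (1 - t * b) * t - q * t * (1 - b * t) * p =
     q * t * ((1 - p) - b * t * (1 - p)) by non_commutative_ring.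
  by rewrite bt subrr mulr0.
- by rewrite -mulrA mulrBl mul1r -(mulrA t) bq mulr0 subr0 qq.
- by rewrite mulrA qq.
Qed.

Lemma inv_up_to_mul_iso t1 t2 p q p1 q1 p2 q2 :
  p * p = p -> q * q = q -> p1 * p1 = p1 -> q1 * q1 = q1 ->
  p2 * p2 = p2 -> q2 * q2 = q2 ->
  inv_up_to (t1 * t2) p q -> inv_up_to t1 p1 q1 -> inv_up_to t2 p2 q2 ->
  exists X Y : 'M[A]_3, [/\ X *m Y = diag3 q p2 p1, Y *m X = diag3 p q2 q1,
    diag3 p q2 q1 *m Y = Y & Y *m diag3 q p2 p1 = Y].
Proof.
move=> pp qq pp1 qq1 pp2 qq2 /(inv_up_toP pp qq) [b [pb bq tb bt]].
move=> /(inv_up_to_dilation pp1 qq1) [b1 [x1 [y1 [z1 [[m1 m2 m3 m4] [[m5 m6 m7 m8] m9]]]]]].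
move=> /(inv_up_to_dilation pp2 qq2) [b2 [x2 [y2 [z2 [[n1 n2 n3 n4] [[n5 n6 n7 n8] n9]]]]]].
(* [S2] dilates t2 and fixes q1 A, mapping A + q2 A + q1 A to A + p2 A + q1 A; [S1] dilates t1 and
   fixes p2 A, mapping on to A + p2 A + p1 A. [T1] and [T2] are their inverses. *)
pose S1 := mx3 t1 0 q1 0 p2 0 p1 0 0.
pose T1 := mx3 b1 0 x1 0 p2 0 y1 0 z1.
pose S2 := mx3 t2 q2 0 p2 0 0 0 0 q1.
pose T2 := mx3 b2 x2 0 y2 z2 0 0 0 q1.
pose z := (mul0r, mulr0, mul1r, mulr1, add0r, addr0).
have ST2 : S2 *m T2 = diag3 1 p2 q1.
  by rewrite mulmx3 !z n1 n2 n3 n4 qq1.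
have TS2 : T2 *m S2 = diag3 1 q2 q1.
  by rewrite mulmx3 !z n5 n6 n7 n8 qq1.
have ST1 : S1 *m T1 = diag3 1 p2 p1.
  by rewrite mulmx3 !z m1 m2 m3 m4 pp2.
have TS1 : T1 *m S1 = diag3 1 p2 q1.
  by rewrite mulmx3 !z m5 m6 m7 m8 pp2.
have S1d : S1 *m diag3 1 p2 q1 = S1 by rewrite mulmx3 !z pp2 qq1.
have dS1 : diag3 1 p2 p1 *m S1 = S1 by rewrite mulmx3 !z pp2 pp1.
have S2d : S2 *m diag3 1 q2 q1 = S2 by rewrite mulmx3 !z qq2 qq1.
have dS2 : diag3 1 p2 q1 *m S2 = S2 by rewrite mulmx3 !z pp2 qq1.
have Sval : S1 *m S2 = mx3 (t1 * t2) (t1 * q2) q1 p2 0 0 (p1 * t2) (p1 * q2) 0.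
  by rewrite mulmx3 !z pp2 qq1.
have sp : (1 - p) * (1 - p) = 1 - p by rewrite mulrBl mul1r mulrBr mulr1 pp subrr subr0.
have sq : (1 - q) * (1 - q) = 1 - q by rewrite mulrBl mul1r mulrBr mulr1 qq subrr subr0.
have pb1 : (1 - p) * b = b by rewrite mulrBl mul1r pb subr0.
have bq1 : b * (1 - q) = b by rewrite mulrBr mulr1 bq subr0.
have [] := @schur_complement_iso 'M[A]_3 (diag3 1 q2 q1) (diag3 1 p2 p1)
   (diag3 (1 - p) 0 0) (diag3 (1 - q) 0 0) (S1 *m S2) (T2 *m T1) (diag3 b 0 0).
- by rewrite -!mulmxE mulmxA -(mulmxA T2) TS1 -mulmxA dS2 TS2.
- by rewrite -!mulmxE mulmxA -(mulmxA S1) ST2 S1d ST1.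
- by rewrite -!mulmxE mulmxA dS1.
- by rewrite -!mulmxE -mulmxA S2d.
- by rewrite -!mulmxE Sval !mulmx3 !z !mulrA -[(1 - q) * t1 * t2]mulrA tb.
- by rewrite -!mulmxE Sval !mulmx3 !z bt.
- by rewrite -!mulmxE !mulmx3 !z bq1.
- by rewrite -!mulmxE !mulmx3 !z pb1.
- by rewrite -!mulmxE !mulmx3 !z.
- by rewrite -!mulmxE !mulmx3 !z.
- by rewrite -!mulmxE !mulmx3 !z.
- by rewrite -!mulmxE !mulmx3 !z.
- by rewrite -!mulmxE !mulmx3 !z sp.
- by rewrite -!mulmxE !mulmx3 !z sq.
- by rewrite -!mulmxE !mulmx3 !z qq2 qq1.
- by rewrite -!mulmxE !mulmx3 !z pp2 pp1.
move=> X [Y]; rewrite -!mulmxE !subr_diag3 !subr0 !subKr => -[XY YX eY Yf].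
by exists X, Y.
Qed.

End IndexMatrices.

(** * Sums of classes and the index formula *)

Section Index.
Variables (R : realType) (A : algType R[i]) (star : A -> A) (nrm : A -> R).
Variable F : A -> Prop.
Hypothesis hC : is_unital_cstar star nrm.
Hypothesis hF : finite_type_algebra star nrm F.
Implicit Types (a b c p q s t v w : A).

Lemma projF_add p q : projF star F p -> projF star F q -> q * p = 0 ->
  projF star F (p + q).
Proof.
move=> [Fp [pp sp]] [Fq [qq sq]] qp.
have pq : p * q = 0 by rewrite -sp -sq -(star_mul hC) qp (star0 hC).
split; first exact: (fta_add hF).
split; last by rewrite (star_add hC) sp sq.
by rewrite mulrDl !mulrDr pp qq pq qp addr0 add0r.
Qed.

Lemma projF0 : projF star F 0.
Proof. by split; [exact: (fta_0 hF) | split; rewrite ?mul0r ?(star0 hC)]. Qed.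

Lemma is_sum_class_orth p q : projF star F p -> projF star F q ->
  exists v, [/\ v * star v = q, v * p = 0, q * v = v,
    projF star F (p + star v * v) & is_sum_class star F p q (p + star v * v)].
Proof.
move=> hp hq; have [v [vq hv vp qv]] := projF_orth hC hF hp hq.
have hs := projF_add hp hv vp.
exists v; split=> //.
  by rewrite -qv -vq -!mulrA (mulrA (star v)) vp mulr0.
split=> //; exists v; split=> //; split=> //; exact/mvn_equiv_refl/hs.2.
Qed.

(** Orthogonal copies of b and c are placed next to a. The fourth class is 0 because the index
    identity is proved with r = 0, already in the semigroup. *)
Lemma is_sum4_class_orth a b c : projF star F a -> projF star F b ->
  projF star F c -> exists v w,
  [/\ v * star v = b, w * star w = c, v * a = 0, w * a = 0 & w * star v = 0] /\
  projF star F (a + star v * v + star w * w) /\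
  is_sum4_class star F a b c 0 (a + star v * v + star w * w).
Proof.
move=> ha hb hc.
have [v [vb va bv h1 c1]] := is_sum_class_orth ha hb.
have [w [wc ws cw h2 c2]] := is_sum_class_orth h1 hc.
have [[_ [aa sa]] [_ [_ sb]]] := (ha, hb).
have av : a * star v = 0 by rewrite -sa -(star_mul hC) va (star0 hC).
have vvv : star v * v * star v = star v.
  by rewrite -mulrA vb -sb -(star_mul hC) bv.
exists v, w; split; last split=> //.
  split=> //.
  - have -> : a = (a + star v * v) * a by rewrite mulrDl aa -mulrA va mulr0 addr0.
    by rewrite mulrA ws mul0r.
  - rewrite -vvv; have -> : star v * v * star v = (a + star v * v) * star v.
      by rewrite mulrDl av add0r.
    by rewrite mulrA ws mul0r.
exists (a + star v * v), (a + star v * v + star w * w); split=> //; split=> //.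
split=> //; exists 0; rewrite (star0 hC) !mul0r addr0; split=> //; split=> //.
exact/mvn_equiv_refl/h2.2.
Qed.

Lemma index_mul p q p1 q1 p2 q2 t1 t2 :
  projF star F p -> projF star F q -> projF star F p1 -> projF star F q1 ->
  projF star F p2 -> projF star F q2 ->
  inv_up_to (t1 * t2) p q -> inv_up_to t1 p1 q1 -> inv_up_to t2 p2 q2 ->
  K_eq_sum star F p q p1 q1 p2 q2.
Proof.
move=> hp hq hp1 hq1 hp2 hq2 i12 i1 i2.
have [_ [pp sp]] := hp; have [_ [qq _]] := hq.
have [_ [pp1 sp1]] := hp1; have [_ [qq1 _]] := hq1.
have [_ [pp2 _]] := hp2; have [_ [qq2 _]] := hq2.
have [X [Y [XY YX eY Yf]]] := inv_up_to_mul_iso pp qq pp1 qq1 pp2 qq2 i12 i1 i2.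
have [v [w [[vq1 wq2 vp wp wv] [hs cs]]]] := is_sum4_class_orth hp hq1 hq2.
have [v' [w' [[vp2 wq vp1 wp1 wv'] [ht ct]]]] := is_sum4_class_orth hp1 hp2 hq.
set s := p + _ + _ in hs cs; set t := p1 + _ + _ in ht ct.
exists 0, s, t; split; [exact: projF0 | split=> //; split=> //].
have adj0 a b : b * star a = 0 -> a * star b = 0.
  by move=> h; rewrite -[LHS](star_invol hC) (star_mul hC) (star_invol hC) h (star0 hC).
have adjp a b : star b = b -> a * b = 0 -> b * star a = 0.
  by move=> sb h; rewrite -{1}sb -(star_mul hC) h (star0 hC).
(* The column [W] and row [Ws] identify diag(p, q2, q1) with the projection s of A, and [Z], [Zs]
   identify diag(q, p2, p1) with t; the entries follow the order of these diagonals. Conjugating X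
   and Y by them turns the matrix isomorphism into elements of A. *)
pose W := col3 [:: p; w; v]; pose Ws := row3 [:: p; star w; star v].
pose Z := col3 [:: w'; v'; p1]; pose Zs := row3 [:: star w'; star v'; p1].
have WWs : W *m Ws = diag3 p q2 q1.
  by rewrite mul_col3_row3 pp wq2 vq1 vp wp wv (adj0 _ _ wv) !adjp.
have ZZs : Z *m Zs = diag3 q p2 p1.
  by rewrite mul_col3_row3 pp1 wq vp2 vp1 wp1 wv' (adj0 _ _ wv') !adjp.
have WsW : (Ws *m W) 0 0 = s by rewrite mul_row3_col3 pp /s addrAC.
have ZsZ : (Zs *m Z) 0 0 = t.
  by rewrite mul_row3_col3 pp1 /t addrC addrCA addrA addrAC; non_commutative_ring.
have [_ [ss _]] := hs; have [_ [tt _]] := ht.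
apply: (projF_iso_mvn_equiv hC hF hs ht (x := (Ws *m Y *m Z) 0 0)
  (y := (Zs *m X *m W) 0 0)); rewrite -mulmx11.
  have -> : Ws *m Y *m Z *m (Zs *m X *m W) = (Ws *m W) *m (Ws *m W).
    by rewrite !mulmxA -(mulmxA _ Z Zs) ZZs -(mulmxA Ws Y) Yf
      -(mulmxA Ws Y X) YX -(mulmxA Ws W Ws) WWs.
  by rewrite mulmx11 WsW ss.
have -> : Zs *m X *m W *m (Ws *m Y *m Z) = (Zs *m Z) *m (Zs *m Z).
  by rewrite !mulmxA -(mulmxA _ W Ws) WWs -(mulmxA _ _ Y) eY
    -(mulmxA Zs X Y) XY -(mulmxA Zs Z Zs) ZZs.
by rewrite mulmx11 ZsZ tt.
Qed.

End Index.

Theorem mainTheorem1 (R : realType) (A : algType R[i]) (star : A -> A)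
  (nrm : A -> R) (F : A -> Prop) :
  is_unital_cstar star nrm ->
  finite_type_algebra star nrm F ->
  forall t1 t2 : A,
    fredholm_type star F t1 -> fredholm_type star F t2 ->
    fredholm_type star F (t1 * t2) /\
    (forall p q p1 q1 p2 q2 : A,
       projF star F p -> projF star F q ->
       projF star F p1 -> projF star F q1 ->
       projF star F p2 -> projF star F q2 ->
       inv_up_to (t1 * t2) p q -> inv_up_to t1 p1 q1 -> inv_up_to t2 p2 q2 ->
       K_eq_sum star F p q p1 q1 p2 q2).
Proof.
move=> hC hF t1 t2 h1 h2; split; first exact: (fredholm_type_mul hC hF h1 h2).
by move=> *; apply: (index_mul hC hF (t1 := t1) (t2 := t2)).
Qed.
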